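(* Let $X$ be an infinite h-homogeneous zero-dimensional compact Hausdorff space, $G=\mathrm{Homeo}(X)$ with the compact-open topology, and $k\ge1$. Then every minimal subsystem $\Sigma\subset\Omega_k$ is a factor of $\Phi(X)$, i.e. there is a continuous $G$-equivariant surjection $\Phi(X)\to\Sigma$.
   Context: h-homogeneous: every nonempty clopen subset of $X$ is homeomorphic to $X$. $\Phi(X)\subset\mathrm{Exp}(\mathrm{Exp}(X))$ is the compact space of maximal chains of nonempty closed subsets of $X$ (maximal families totally ordered by inclusion, Vietoris topologies), with $gc=\{gF:F\in c\}$. $\mathcal D_k$ is the set of ordered partitions $(B_1,\dots,B_k)$ of $X$ into $k$ nonempty clopen sets, on which $G$ acts piecewise. $\Omega_k=\{1,-1\}^{\mathcal D_k}$ with the product topology and $G$-action $(g\omega)(\beta)=\omega(g^{-1}\beta)$. A minimal subsystem is a nonempty closed $G$-invariant subset containing no smaller such subset. *)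

(* Defs.v *)
From HB Require Import structures.
From mathcomp Require Import all_boot all_order all_algebra.
From mathcomp Require Import all_classical all_reals all_analysis.
Set Implicit Arguments. Unset Strict Implicit. Unset Printing Implicit Defensive.
Local Open Scope classical_set_scope.

Definition clopen_base (X : topologicalType) : Prop :=
  forall (x : X) (U : set X), open U -> U x ->
    exists C : set X, [/\ clopen C, C x & C `<=` U].

Definition homeomorphic_to_whole (X : topologicalType) (A : set X) : Prop :=
  exists f g : X -> X,
    [/\ {within A, continuous f}, continuous g,
        (forall y, A (g y)), (forall y, f (g y) = y) &
        (forall a, A a -> g (f a) = a)].

Definition h_homogeneous (X : topologicalType) : Prop :=
  forall A : set X, clopen A -> A !=set0 -> homeomorphic_to_whole A.

Record homeo (X : topologicalType) := Homeo {
  hfun : X -> X;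
  hinv : X -> X;
  hfunK : cancel hfun hinv;
  hinvK : cancel hinv hfun;
  hfun_cont : continuous hfun;
  hinv_cont : continuous hinv }.

Definition homeo_inverse (X : topologicalType) (g : homeo X) : homeo X :=
  @Homeo X (hinv g) (hfun g) (@hinvK X g) (@hfunK X g) (@hinv_cont X g) (@hfun_cont X g).

Definition gen_open (A : Type) (S : set (set A)) (W : set A) : Prop :=
  forall a, W a -> exists (n : nat) (V : 'I_n -> set A),
    [/\ forall i, S (V i), forall i, V i a &
        forall b, (forall i, V i b) -> W b].

Definition vietoris_subbase (T : Type) (op : set T -> Prop) : set (set (set T)) :=
  [set W | exists U, op U /\
     (W = [set F | F `<=` U] \/ W = [set F | F `&` U !=set0])].

(* Vietoris topology on Exp(X) (nonempty closed subsets of X) *)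
Definition exp_open (X : topologicalType) : set (set X) -> Prop :=
  gen_open (vietoris_subbase (@open X)).

Definition exp2_open (X : topologicalType) : set (set (set X)) -> Prop :=
  gen_open (vietoris_subbase (@exp_open X)).

Definition is_chain (X : topologicalType) (c : set (set X)) : Prop :=
  (forall F, c F -> closed F /\ F !=set0) /\
  (forall F F', c F -> c F' -> F `<=` F' \/ F' `<=` F).

Definition maximal_chain (X : topologicalType) (c : set (set X)) : Prop :=
  is_chain c /\ (forall c', is_chain c' -> c `<=` c' -> c' = c).

Definition Phi (X : topologicalType) : set (set (set X)) := [set c | maximal_chain c].

Definition chain_act (X : topologicalType) (g : homeo X) (c : set (set X)) :
  set (set X) := (fun F => hfun g @` F) @` c.

Definition ordpartb (X : topologicalType) (k : nat) (B : 'I_k -> set X) : Prop :=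
  [/\ forall i, clopen (B i), forall i, B i !=set0,
      forall i j, i != j -> B i `&` B j = set0 &
      forall x, exists i, B i x].

Definition ordpart (X : topologicalType) (k : nat) := {B : 'I_k -> set X | ordpartb B}.

Lemma homeo_imageE (X : topologicalType) (g : homeo X) (A : set X) :
  hfun g @` A = hinv g @^-1` A.
Proof.
apply/seteqP; split => x /=.
  by case=> a Aa <-; rewrite hfunK.
by move=> Ax; exists (hinv g x) => //; rewrite hinvK.
Qed.

Lemma ordpartb_act (X : topologicalType) (k : nat) (g : homeo X) (B : 'I_k -> set X) :
  ordpartb B -> ordpartb (fun i => hfun g @` B i).
Proof.
case=> cl ne dj cv; split.
- move=> i; rewrite homeo_imageE; case: (cl i) => oB cB; split.
    by apply: open_comp => // x _; exact: hinv_cont.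
  have -> : hinv g @^-1` B i = ~` (hinv g @^-1` ~` B i).
    by apply/seteqP; split => x /=; [move=> ? []|move/contrapT].
  apply: open_closedC; apply: open_comp; first by move=> x _; exact: hinv_cont.
  exact: closed_openC.
- move=> i; case: (ne i) => x Bx; exists (hfun g x); by exists x.
- move=> i j ij; rewrite !homeo_imageE; apply/seteqP; split => x //= [a b].
  have : (B i `&` B j) (hinv g x) by split.
  by rewrite (dj i j ij).
- move=> x; case: (cv (hinv g x)) => i Bi; exists i; rewrite homeo_imageE.
  exact: Bi.
Qed.

Definition part_act (X : topologicalType) (k : nat) (g : homeo X) (b : ordpart X k) :
  ordpart X k := exist _ (fun i => hfun g @` proj1_sig b i)
                         (ordpartb_act g (proj2_sig b)).

(* ---------- Omega_k = {1,-1}^{D_k} (true <-> 1, false <-> -1) ---------- *)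

Definition Omega (X : topologicalType) (k : nat) := ordpart X k -> bool.

Definition omega_act (X : topologicalType) (k : nat) (g : homeo X) (w : Omega X k) :
  Omega X k := fun b => w (part_act (homeo_inverse g) b).

Definition omega_open (X : topologicalType) (k : nat) : set (Omega X k) -> Prop :=
  gen_open [set W | exists (b : ordpart X k) (s : bool), W = [set w | w b = s]].

Definition omega_closed (X : topologicalType) (k : nat) (S : set (Omega X k)) : Prop :=
  omega_open (~` S).

Definition omega_subsystem (X : topologicalType) (k : nat) (S : set (Omega X k)) : Prop :=
  [/\ S !=set0, omega_closed S &
      forall (g : homeo X) w, S w -> S (omega_act g w)].

Definition minimal_subsystem (X : topologicalType) (k : nat) (S : set (Omega X k)) : Prop :=
  omega_subsystem S /\ (forall S', omega_subsystem S' -> S' `<=` S -> S' = S).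

(* continuity of p : Phi(X) -> Omega_k (subspace topologies): preimages of
   subbasic cylinders are relatively open in Phi(X) *)
Definition phi_continuous (X : topologicalType) (k : nat)
    (p : set (set X) -> Omega X k) : Prop :=
  forall (b : ordpart X k) (s : bool) c, @Phi X c -> p c b = s ->
    exists W, [/\ exp2_open W, W c &
                  forall c', @Phi X c' -> W c' -> p c' b = s].

Definition factor_of_Phi (X : topologicalType) (k : nat) (S : set (Omega X k)) : Prop :=
  exists p : set (set X) -> Omega X k,
    [/\ forall c, @Phi X c -> S (p c),
        forall w, S w -> exists2 c, @Phi X c & p c = w,
        phi_continuous p &
        forall (g : homeo X) c, @Phi X c -> p (chain_act g c) = omega_act g (p c)].

(* Main.v *)
(** Write [A <_c B] when some member of the maximal chain [c] meets [A] and misses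
    [B]: this linearly orders the blocks of any clopen partition, so [c] assigns
    to an ordered partition [b] the vector [rank c b] of the positions of its
    blocks. Given a point [w] of the minimal system [S], the dual Ramsey theorem
    (Graham-Rothschild, here from Hales-Jewett) provides a function [f] of such
    vectors and arbitrarily fine partitions all of whose ordered coarsenings [b]
    are coloured by [w] according to [f] and the order in which the blocks of
    [b] first appear. By h-homogeneity a homeomorphism carries such a partition
    onto any partition sorted by [c], so the point [b |-> f (rank c b)] is in
    the orbit closure of [w], for every [c]. This defines the factor map; its
    image is closed, as limits of the orders [<_c] along ultrafilters come from
    maximal chains, hence it is all of [S] by minimality. *)

Require Import Defs.
From mathcomp Require Import all_boot all_order all_algebra.
From mathcomp Require Import all_classical all_reals all_analysis.
From mathcomp Require Import zify.
Set Implicit Arguments. Unset Strict Implicit. Unset Printing Implicit Defensive.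
Local Open Scope nat_scope.
Local Open Scope classical_set_scope.

(** * Parameter words and the dual Ramsey theorem *)

Definition word (a : nat) (s : seq nat) : bool := all (fun x => x < a) s.

(* Letters are [0 .. a-1], parameters are [a .. a+k-1]; once read, a parameter
   counts as a letter, which forces first occurrences to be in order. *)
Fixpoint pword (a k : nat) (w : seq nat) : bool :=
  if w is x :: w' then
    (x < a) && pword a k w' || [&& x == a, 0 < k & pword a.+1 k.-1 w']
  else k == 0.

(** Looking symbols up in [iota 0 a ++ u] fixes the letters and replaces the parameter [a + i] by
    entry [i] of [u]: this composes parameter words. *)
Definition subst (a : nat) (v u : seq nat) : seq nat :=
  [seq nth 0 (iota 0 a ++ u) x | x <- v].

Lemma size_subst a v u : size (subst a v u) = size v.
Proof. by rewrite size_map. Qed.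

Lemma word_tuple a n s : size s = n -> word a s ->
  exists t : n.-tuple 'I_a, s = map val t.
Proof.
move=> sn ws.
have [t ht] : exists t : seq 'I_a, s = map val t.
  elim: s ws {sn} => [|x s IH] /=; first by exists [::].
  by case/andP=> xa /IH[t ->]; exists (Ordinal xa :: t).
have st : size t == n by rewrite -sn ht size_map.
by exists (Tuple st).
Qed.

Lemma wordW a b s : a <= b -> word a s -> word b s.
Proof. by move=> ab; apply: sub_all => x /leq_trans; apply. Qed.

Lemma pword0_word a s : pword a 0 s -> word a s.
Proof. by elim: s => //= x s IH; rewrite andbF orbF => /andP[-> /IH]. Qed.

Lemma pword_word a k w : pword a k w -> word (a + k) w.
Proof.
elim: w a k => //= x w IH a k /orP[/andP[xa /IH ->]|/and3P[/eqP-> k0 /IH]].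
  by rewrite andbT ltn_addr.
by rewrite addSnnS prednK // => ->; rewrite andbT -[X in X < _]addn0 ltn_add2l.
Qed.

Lemma pword_cat a k p w : word a p -> pword a k (p ++ w) = pword a k w.
Proof.
elim: p => //= x p IH /andP[xa /IH ->]; rewrite xa /=.
by rewrite (ltn_eqF xa) /= orbF.
Qed.

Lemma pword_param a k w : pword a k.+1 (a :: w) = pword a.+1 k w.
Proof. by rewrite /= ltnn eqxx. Qed.

Lemma pword_split a k w : pword a k.+1 w ->
  exists p b, [/\ w = p ++ a :: b, word a p & pword a.+1 k b].
Proof.
elim: w => //= x w IH /orP[/andP[xa /IH[p [b [-> wp pb]]]]|/andP[/eqP-> pb]].
  by exists (x :: p), b; rewrite /= xa.
by exists [::], w.
Qed.

(** The environment [e] holds the values of the letters of [v]. Reading a parameter of [v] moves the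
    head of [u] to the end of [e], so that the alphabets [b] of [v] and [a] of the result grow
    independently along the induction. *)
Lemma pword_map a b k n e u v : size e = b -> word a e -> pword b n v ->
  size u = n -> pword a k u -> pword a k (map (nth 0 (e ++ u)) v).
Proof.
elim: v a b k n e u => [|x v IH] a b k n e u se we /=.
  by move=> /eqP-> /size0nil->.
case/orP=> [/andP[xb pv] su pu|/and3P[/eqP-> n0 pv]].
  rewrite nth_cat se xb (IH _ _ _ _ _ _ se we pv su pu) andbT.
  by move/allP: we => -> //; rewrite mem_nth // se.
case: u => [|y u] /=; first by move=> n1; rewrite -n1 in n0.
move=> su; rewrite nth_cat se ltnn subnn /= -cat_rcons.
case/orP=> [/andP[ya pu]|/and3P[/eqP ya k0 pu]].
  rewrite ya (IH _ _ _ _ _ _ _ _ pv _ pu) ?size_rcons ?se -?su //.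
  by rewrite /word all_rcons ya.
rewrite ya eqxx k0 /= (IH _ _ _ _ _ _ _ _ pv _ pu) ?size_rcons ?se -?su ?orbT //.
by rewrite /word all_rcons leqnn; apply: wordW we.
Qed.

Lemma word_iota a : word a (iota 0 a).
Proof. by apply/allP=> x; rewrite mem_iota. Qed.

Lemma pword_subst a k n v u : pword a n v -> size u = n -> pword a k u ->
  pword a k (subst a v u).
Proof. by move=> pv su; apply: (pword_map _ _ pv su); rewrite ?size_iota ?word_iota. Qed.

Lemma map_nth_comp e e' v : word (size e') v ->
  map (nth 0 e) (map (nth 0 e') v) = map (nth 0 (map (nth 0 e) e')) v.
Proof.
move/allP=> wv; rewrite -map_comp; apply/eq_in_map => x /wv xe /=.
by rewrite (nth_map 0).
Qed.

Lemma map_nth_prefix e u : map (nth 0 (e ++ u)) (iota 0 (size e)) = e.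
Proof.
apply: (@eq_from_nth _ 0); first by rewrite size_map size_iota.
move=> i; rewrite size_map size_iota => ie.
by rewrite (nth_map 0) ?size_iota // nth_iota // nth_cat ie.
Qed.

Lemma substA a v w u : word (a + size w) v ->
  subst a (subst a v w) u = subst a v (subst a w u).
Proof.
move=> wv; rewrite /subst map_nth_comp ?size_cat ?size_iota // map_cat.
by have := map_nth_prefix (iota 0 a) u; rewrite size_iota => ->.
Qed.

(** Room is made for a new letter [c], which the shifted word avoids; for [c = a] the letters stay
    and the parameters move up by one. *)
Lemma pword_bump c a n v : c <= a -> pword a n v -> pword a.+1 n (map (bump c) v).
Proof.
elim: v a n => //= x v IH a n ca /orP[/andP[xa pv]|/and3P[/eqP-> n0 pv]].
  rewrite IH // andbT; apply/orP; left.
  by rewrite /bump; case: (c <= x) => /=; rewrite ?add1n ?add0n ltnS // ltnW.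
by rewrite (IH _ _ (leqW ca) pv) /bump ca add1n eqxx n0 orbT.
Qed.

Lemma nth_letter a u x : x < a -> nth 0 (iota 0 a ++ u) x = x.
Proof. by move=> xa; rewrite nth_cat size_iota xa nth_iota. Qed.

Lemma nth_param a x u : nth 0 (iota 0 a ++ x :: u) a = x.
Proof. by rewrite nth_cat size_iota ltnn subnn. Qed.

Lemma nth_bump a x u y : nth 0 (iota 0 a ++ x :: u) (bump a y) = nth 0 (iota 0 a ++ u) y.
Proof.
rewrite !nth_cat size_iota /bump; case: (leqP a y) => ay /=.
  by rewrite add1n ltnNge leqW //= subSn.
by rewrite add0n ay.
Qed.

Lemma map_nth_bump a x u v :
  map (nth 0 (iota 0 a ++ x :: u)) (map (bump a) v) = subst a v u.
Proof. by rewrite -map_comp; apply: eq_map => y /=; rewrite nth_bump. Qed.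

(** * The Hales-Jewett theorem *)

Lemma pigeonhole (D : finType) (h : nat -> D) :
  exists i j, [/\ i < j, j <= #|D| & h i = h j].
Proof.
have /injectivePn[i [j ij hij]] : ~~ injectiveb (fun i : 'I_#|D|.+1 => h i).
  by apply/negP => /injectiveP /leq_card; rewrite card_ord ltnn.
have [lt|lt|/val_inj e] := ltngtP i j; last by rewrite e eqxx in ij.
  by exists i, j; split=> //; rewrite -ltnS.
by exists j, i; split=> //; rewrite -ltnS.
Qed.

(* Shelah's cube lemma: each parameter is a block [a+1 .. a+1 x .. x a .. a],
   whose two ends come from the pigeonhole principle on step-shaped blocks. *)
Lemma shelah_insensitive a n (C : finType) :
  exists N, forall chi : seq nat -> C, exists v,
  [/\ size v = N, pword a.+2 n v & forall s, size s = n -> word a.+2 s ->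
    chi (subst a.+2 v s) = chi (subst a.+2 v (map (minn^~ a) s))].
Proof.
elim: n C => [|n IH] C.
  by exists 0 => chi; exists [::]; split=> // -[].
pose m := #|{ffun n.-tuple 'I_a.+2 -> C}|.
(* A colour here records the values for all first blocks of length [m] at once, so the tail [v2] is
   insensitive whatever the first block. In turn [m] counts the values of [h], which tests a first
   block against all tails. *)
have [N2 H2] := IH {ffun m.-tuple 'I_a.+2 -> C}.
exists (m + N2) => chi.
have [v2 [sv2 pv2 ins2]] :=
  H2 (fun s => [ffun t : m.-tuple 'I_a.+2 => chi (map val t ++ s)]).
pose h i := [ffun t : n.-tuple 'I_a.+2 =>
  chi ((nseq i a.+1 ++ nseq (m - i) a) ++ subst a.+2 v2 (map val t))].
have [i [j [ij jm hij]]] := pigeonhole h.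
rewrite -/m in jm.
(* Putting [a.+1] or [a] for the first parameter [a.+2] gives the step blocks with step at [j] or at
   [i], which [h] does not distinguish. *)
pose v := nseq i a.+1 ++ nseq (j - i) a.+2 ++ nseq (m - j) a ++ map (bump a.+2) v2.
have vE x s : subst a.+2 v (x :: s) =
    (nseq i a.+1 ++ nseq (j - i) x ++ nseq (m - j) a) ++ subst a.+2 v2 s.
  rewrite /subst !map_cat !map_nseq map_nth_bump -!catA.
  by rewrite nth_param !nth_letter.
exists v; split.
- by rewrite !size_cat !size_nseq size_map sv2; lia.
- rewrite /v pword_cat; last by apply/allP => x /nseqP[-> _].
  rewrite -[j - i]prednK ?subn_gt0 //= ltnn eqxx /=.
  rewrite !pword_cat ?pword_bump //; apply/allP => x /nseqP[-> _] //; lia.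
- case=> [//|x s] [sn] /= /andP[xa ws].
  rewrite !vE.
  set P := nseq i _ ++ nseq _ x ++ _.
  have wP : word a.+2 P.
    rewrite /P /word !all_cat !all_nseq xa; apply/and3P; split; lia.
  have sP : size P = m by rewrite !size_cat !size_nseq; lia.
  have [t Pt] := word_tuple sP wP.
  have -> : chi (P ++ subst a.+2 v2 s) = chi (P ++ subst a.+2 v2 (map (minn^~ a) s)).
    have /ffunP := ins2 s sn ws; by move=> /(_ t); rewrite !ffunE -Pt.
  have [xa1|xa1] := ltnP x a.+1; first by rewrite /P (minn_idPl _).
  have xE : x = a.+1 by lia.
  have sm : size (map (minn^~ a) s) = n by rewrite size_map.
  have /(word_tuple sm)[t' st'] : word a.+2 (map (minn^~ a) s).
    by apply/allP => _ /mapP[y _ ->]; lia.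
  have /ffunP/(_ t') := hij; rewrite !ffunE -st' => e.
  rewrite /P (minn_idPr _) ?(ltnW xa1) // xE.
  have -> : nseq i a.+1 ++ nseq (j - i) a.+1 ++ nseq (m - j) a =
      nseq j a.+1 ++ nseq (m - j) a by rewrite catA -nseqD subnKC // ltnW.
  have -> : nseq i a.+1 ++ nseq (j - i) a ++ nseq (m - j) a =
      nseq i a.+1 ++ nseq (m - i) a.
    by rewrite -nseqD; congr (_ ++ nseq _ _); lia.
  by rewrite -e.
Qed.

(** Induction on the alphabet: inside a word insensitive to replacing [a.+1] by [a], a word that is
    monochromatic for the smaller alphabet stays so for the larger one. *)
Lemma hales_jewett a n (C : finType) :
  exists N, forall chi : seq nat -> C, exists v c,
  [/\ size v = N, pword a.+1 n v &
      forall s, size s = n -> word a.+1 s -> chi (subst a.+1 v s) = c].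
Proof.
elim: a n C => [|a IH] n C.
  exists n => chi; exists (iota 1 n), (chi (subst 1 (iota 1 n) (nseq n 0))).
  split; first by rewrite size_iota.
    by elim: n 1 => //= n IH a; rewrite eqxx IH orbT.
  move=> s sn ws; congr (chi (subst _ _ _)).
  by rewrite -sn; apply/all_pred1P; apply: sub_all ws => x; rewrite ltnS leqn0.
have [N0 H0] := IH n C.
have [N H] := shelah_insensitive a N0 C.
exists N => chi.
have [v [sv pv ins]] := H chi.
have [w [c [sw pw cst]]] := H0 (fun s => chi (subst a.+2 v s)).
pose w' := map (bump a.+1) w.
have pw' : pword a.+2 n w' by exact: pword_bump.
exists (subst a.+2 v w'), c; split; first by rewrite size_subst.
  by apply: pword_subst pv _ pw'; rewrite size_map.
move=> s sn ws; rewrite substA; last by rewrite size_map sw; apply: pword_word.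
rewrite ins ?size_subst ?size_map //; last first.
  have : pword a.+2 0 (subst a.+2 w' s).
    apply: pword_subst pw' sn _.
    by rewrite -(cats0 s) pword_cat.
  exact: pword0_word.
rewrite -(cst (map (minn^~ a) s)) ?size_map //; last first.
  by apply/allP => _ /mapP[y _ ->]; lia.
congr (chi (subst _ _ _)); rewrite /subst /w' -!map_comp.
apply/eq_in_map => y yw; rewrite /comp.
have ylt : y < a.+1 + n by move/allP: (pword_word pw); apply.
rewrite !nth_cat !size_iota /bump; case: (leqP a.+1 y) => ya.
  rewrite add1n ltnNge ltnS ya subSS (nth_map 0) //.
  by rewrite sn; lia.
rewrite add0n (leqW ya) !nth_iota //; last exact: leqW.
by rewrite !add0n; apply/minn_idPl.
Qed.

(** * From Hales-Jewett to Graham-Rothschild *)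

Definition pre (a : nat) (w : seq nat) : seq nat := take (index a w) w.

Lemma pre_cat a q r : word a q -> pre a (q ++ a :: r) = q.
Proof.
move=> wq; rewrite /pre index_cat; case: ifP => [aq|_].
  by move/allP: wq => /(_ a aq); rewrite ltnn.
by rewrite /= eqxx addn0 take_size_cat.
Qed.

(** Parameters first occur in order, so before the one that receives [a] is met, only [e] and [p]
    are looked up. Hence [q] can be chosen before [r]. *)
Lemma subst_prefix_env a b n e p v : size e = b -> word a e -> pword b n v ->
  word a p -> size p < n ->
  exists q, word a q /\ forall r, size p + (size r).+1 = n ->
    exists r', map (nth 0 (e ++ p ++ a :: r)) v = q ++ a :: r'.
Proof.
elim: v b n e p => [|x v IH] b n e p se we /=; first by move=> /eqP->.
case/orP=> [/andP[xb pv] wp pn|/and3P[/eqP-> n0 pv] wp pn].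
  have [q [wq Hq]] := IH _ _ _ _ se we pv wp pn.
  exists (nth 0 e x :: q); split.
    by rewrite /= wq andbT; move/allP: we => -> //; rewrite mem_nth // se.
  move=> r /Hq[r' ->]; exists r'; by rewrite nth_cat se xb.
case: p wp pn => [_ _|y p /= /andP[ya wp] pn].
  exists [::]; split=> // r _; rewrite /= nth_cat se ltnn subnn /=.
  by eexists.
have pn' : size p < n.-1 by case: n n0 pn {pv}.
have [||q [wq Hq]] := IH b.+1 n.-1 (rcons e y) p _ _ pv wp pn'.
- by rewrite size_rcons se.
- by rewrite /word all_rcons ya.
exists (y :: q); split; first by rewrite /= ya.
move=> r sr; have [|r' e1] := Hq r; first by rewrite -sr.
by exists r'; rewrite /= nth_cat se ltnn subnn /= -cat_rcons e1.
Qed.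

Lemma subst_prefix a n p v : pword a n v -> word a p -> size p < n ->
  exists q, word a q /\ forall r, size p + (size r).+1 = n ->
    exists r', subst a v (p ++ a :: r) = q ++ a :: r'.
Proof. by apply: subst_prefix_env; rewrite ?size_iota ?word_iota. Qed.

Lemma subst_cat a v u t : word (a + size u) v -> subst a v (u ++ t) = subst a v u.
Proof.
move=> /allP wv; apply/eq_in_map => x /wv xlt.
by rewrite catA nth_cat size_cat size_iota xlt.
Qed.

Lemma pword_rcons a n w : pword a n w -> pword a n.+1 (rcons w (a + n)).
Proof.
elim: w a n => /= [|x w IH] a n; first by move=> /eqP->; rewrite addn0 eqxx orbT.
case/orP=> [/andP[-> /IH->] //|/and3P[-> n0 /IH]].
by rewrite addSnnS prednK // => ->; rewrite orbT.
Qed.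

(** Induction on [n], appending a fresh last parameter. If it is the first to receive [a.+1], the
    prefix is a full instance of [v], coloured by Hales-Jewett; otherwise the induction hypothesis
    applies to prefixes of instances of [v]. *)
Lemma hales_jewett_prefixes a n (C : finType) :
  exists M, forall psi : seq nat -> C, exists w (col : nat -> C),
  [/\ size w = M, pword a.+1 n w &
    forall p r, word a.+1 p -> size p + (size r).+1 = n ->
    psi (pre a.+1 (subst a.+1 w (p ++ a.+1 :: r))) = col (size p)].
Proof.
elim: n C => [|n IH] C.
  by exists 0 => psi; exists [::], (fun=> psi [::]); split.
have [M HM] := IH C; have [N HN] := hales_jewett a M C.
exists N.+1 => psi; set A := a.+1.
have [v [c [sv pv cst]]] := HN psi.
(* The prefix depends on [q] only, so any filling starting with [A] will do. *)
have [w [col [sw pw Hw]]] :=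
  HM (fun q => psi (pre A (subst A v (q ++ nseq (M - size q) A)))).
have wvw : word (A + size w) v by rewrite sw; apply: pword_word.
exists (rcons (subst A v w) (A + n)), (fun i => if i < n then col i else c); split.
- by rewrite size_rcons size_subst sv.
- exact/pword_rcons/(pword_subst pv).
move=> p r wp spr.
have -> : subst A (rcons (subst A v w) (A + n)) (p ++ A :: r) =
    rcons (subst A v (subst A w (p ++ A :: r))) (nth 0 (p ++ A :: r) n).
  by rewrite -substA // /subst map_rcons nth_cat size_iota ltnNge leq_addr /= addKn.
case: (lastP r) spr => [|{}r y].
  rewrite addn1 => -[spn]; rewrite spn ltnn.
  rewrite nth_cat spn ltnn subnn /= subst_cat; last by rewrite spn; apply: pword_word.
  have wwp : word A (subst A w p).
    apply: pword0_word; apply: pword_subst pw spn _.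
    by rewrite -(cats0 p) pword_cat.
  rewrite -cats1 pre_cat; first by rewrite cst ?size_subst.
  apply: pword0_word; apply: pword_subst pv _ _; first by rewrite size_subst.
  by rewrite -(cats0 (subst _ _ _)) pword_cat.
rewrite size_rcons addnS => -[spn].
have ltpn : size p < n by rewrite -spn addnS ltnS leq_addr.
have -> : p ++ A :: rcons r y = (p ++ A :: r) ++ [:: y] by rewrite -catA /= cats1.
rewrite ltpn.
have [q [wq /(_ r spn)[r1 e1]]] := subst_prefix pw wp ltpn.
have -> : subst A w ((p ++ A :: r) ++ [:: y]) = q ++ A :: r1.
  rewrite subst_cat ?e1 // size_cat /= spn; exact: pword_word.
have sq : size q + (size r1).+1 = M by rewrite -sw -(size_subst A w (p ++ A :: r)) e1 size_cat.
have ltqM : size q < M by rewrite -sq addnS ltnS leq_addr.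
have [q2 [wq2 H2]] := subst_prefix pv wq ltqM.
have [r2 ->] := H2 r1 sq.
rewrite rcons_cat /= pre_cat // -(Hw p r wp spn) e1 pre_cat //.
have -> : M - size q = (size r1).+1 by rewrite -sq addKn.
have [|r3 ->] := H2 (nseq (size r1) A); first by rewrite size_nseq.
by rewrite pre_cat.
Qed.

(** Parameters go to the first [n] true positions of [bs] and the letter [0] elsewhere; as [0 < b],
    this filler takes a value from [e], below [a]. *)
Lemma pword_select (bs : seq bool) n a b : 0 < b -> n <= count id bs ->
  exists w, [/\ size w = size bs, pword b n w &
    forall e p r, size e = b -> word a e -> word a p -> size p + (size r).+1 = n ->
    exists q r', [/\ map (nth 0 (e ++ p ++ a :: r)) w = q ++ a :: r', word a q &
                     nth false bs (size q)]].
Proof.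
elim: bs n b => [|d bs IH] n b b0 /=.
  rewrite leqn0 => /eqP->; exists [::]; split=> // e p r _ _ _.
  by rewrite addnS.
have skip m : m <= count id bs -> exists w, [/\ size w = (size bs).+1, pword b m w &
    forall e p r, size e = b -> word a e -> word a p -> size p + (size r).+1 = m ->
    exists q r', [/\ map (nth 0 (e ++ p ++ a :: r)) w = q ++ a :: r', word a q &
                     nth false (d :: bs) (size q)]].
  move=> /(IH _ _ b0)[w [sw pw H]]; exists (0 :: w); split; rewrite /= ?sw ?b0 ?pw //.
  move=> e p r se we wp spr; have [q [r' [e1 wq nq]]] := H e p r se we wp spr.
  exists (nth 0 e 0 :: q), r'; rewrite nth_cat se b0 e1; split=> //=.
  by rewrite wq andbT; move/allP: we => -> //; rewrite mem_nth // se.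
case: d skip => skip; last exact: skip.
case: n => [_|n]; first exact: skip.
rewrite add1n ltnS => /(IH _ b.+1 isT)[w [sw pw H]].
exists (b :: w); split; rewrite /= ?sw ?eqxx ?pw ?orbT //.
move=> e [|y p] r se we /= wp spr.
  by rewrite nth_cat se ltnn subnn /=; eexists [::], _; split.
case/andP: wp => ya wp.
have [||||q [r' [e1 wq nq]]] := H (rcons e y) p r => //.
- by rewrite size_rcons se.
- by rewrite /word all_rcons ya.
- by move: spr; rewrite addSn => -[].
exists (y :: q), r'; rewrite nth_cat se ltnn subnn /= -cat_rcons e1.
by split=> //; rewrite /= ya.
Qed.

Lemma popular_colour (C : finType) (h : nat -> C) n :
  exists c, n <= count (fun j => h j == c) (iota 0 (#|C| * n)).
Proof.
apply/existsP; apply: contraT; rewrite negb_exists => /forallP small.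
have sumE (s : seq nat) : \sum_(c : C) count (fun j => h j == c) s = size s.
  elim: s => [|x s IH]; first by rewrite big1.
  rewrite /= -IH big_split /= (bigD1 (h x)) //= eqxx big1 ?addn0 // => c.
  by rewrite eq_sym => /negbTE->.
have n0 : 0 < n by have := small (h 0); rewrite -ltnNge; apply: leq_ltn_trans.
have C0 : 0 < #|C| by apply/card_gt0P; exists (h 0).
have : \sum_(c : C) count (fun j => h j == c) (iota 0 (#|C| * n)) <= \sum_(c : C) n.-1.
  by apply: leq_sum => c _; rewrite -ltnS prednK // ltnNge.
by rewrite sumE size_iota sum_nat_const leq_pmul2l // leqNgt prednK // leqnn.
Qed.

(** Among [#|C| * n] parameters whose prefix colour depends on the position only, [n] share one
    colour; the others are eliminated by [pword_select]. *)
Lemma prefix_ramsey a n (C : finType) :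
  exists M, forall psi : seq nat -> C, exists w c,
  [/\ size w = M, pword a.+1 n w &
    forall p r, word a.+1 p -> size p + (size r).+1 = n ->
    psi (pre a.+1 (subst a.+1 w (p ++ a.+1 :: r))) = c].
Proof.
have [M HM] := hales_jewett_prefixes a (#|C| * n) C; exists M => psi.
have [w [col [sw pw Hw]]] := HM psi.
have [c cn] := popular_colour col n.
pose bs := [seq col j == c | j <- iota 0 (#|C| * n)].
have [|w' [sw' pw' Hw']] := @pword_select bs n a.+1 a.+1 isT; first by rewrite count_map.
have sbs : size bs = #|C| * n by rewrite size_map size_iota.
rewrite sbs in sw'.
exists (subst a.+1 w w'), c; split; first by rewrite size_subst.
  exact: pword_subst pw _ pw'.
move=> p r wp spr; rewrite substA; last by rewrite sw'; apply: pword_word.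
have [||q [r' [e1 wq nq]]] := Hw' (iota 0 a.+1) p r _ _ wp spr.
- by rewrite size_iota.
- exact: word_iota.
have sq : size q + (size r').+1 = #|C| * n.
  by rewrite -sw' -(size_map (nth 0 (iota 0 a.+1 ++ p ++ a.+1 :: r)) w') e1 size_cat.
rewrite /subst e1 Hw //.
have lt : size q < #|C| * n by rewrite -sq addnS ltnS leq_addr.
by move: nq; rewrite (nth_map 0) ?size_iota // nth_iota // add0n => /eqP.
Qed.

Definition graham_rothschild_for a k := forall n (C : finType),
  exists N, forall chi : seq nat -> C, exists v c,
  [/\ size v = N, pword a n v &
      forall u, size u = n -> pword a k u -> chi (subst a v u) = c].

(* What follows the first parameter is a [k]-parameter word over the alphabet
   enlarged by that parameter, so Graham-Rothschild for [k] applies to it. *)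
Lemma ramsey_up_to_prefix a k n (C : finType) : graham_rothschild_for a.+2 k ->
  exists N, forall chi : seq nat -> C, exists v (col : seq nat -> C),
  [/\ size v = N, pword a.+1 n v &
    forall p b, word a.+1 p -> pword a.+2 k b -> size p + (size b).+1 = n ->
    chi (subst a.+1 v (p ++ a.+1 :: b)) = col p].
Proof.
move=> GR; elim: n C => [|n IH] C.
  by exists 0 => chi; exists [::], (fun=> chi [::]); split.
have [N2 H2] := IH {ffun 'I_a.+1 -> C}; have [N1 H1] := GR N2 C.
exists N1.+1 => chi; set A := a.+1.
have [v1 [c1 [sv1 pv1 Hv1]]] := H1 (fun b => chi (A :: b)).
(* [v1] settles the words starting with the parameter [A]. For those starting with a letter [x],
   which then also replaces [A] inside [v1], a colour for [v2] is a function of [x]. *)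
have [v2 [col2 [sv2 pv2 Hv2]]] := H2 (fun u =>
  [ffun x : 'I_A => chi (val x :: map (nth 0 (iota 0 A ++ val x :: u)) v1)]).
pose v2' := map (bump A) v2.
have pv2' : pword A.+1 n v2' by exact: pword_bump.
have sv2' : size v2' = N2 by rewrite size_map.
exists (A :: subst A.+1 v1 v2').
exists (fun p => if p is x :: p' then col2 p' (inord x) else c1).
have vE x u : subst A (A :: subst A.+1 v1 v2') (x :: u) =
    x :: map (nth 0 (iota 0 A ++ x :: subst A v2 u)) v1.
  rewrite /subst map_cons nth_param; congr (_ :: _).
  rewrite map_nth_comp; last first.
    by rewrite size_cat size_iota sv2'; apply: pword_word.
  rewrite map_cat /v2' map_nth_bump -addn1 iotaD map_cat -catA.
  rewrite add0n (_ : iota A 1 = [:: A]) // map_cons nth_param.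
  by have := map_nth_prefix (iota 0 A) (x :: u); rewrite size_iota => ->.
split.
- by rewrite /= size_subst sv1.
- rewrite pword_param; exact: pword_subst pv1 sv2' pv2'.
case=> [|x p] b wp pb; rewrite ?cat0s ?cat_cons ?add0n ?addSn => -[spb].
  rewrite vE.
  have -> : iota 0 A ++ A :: subst A v2 b = iota 0 A.+1 ++ subst A.+1 v2' b.
    rewrite -(addn1 A) iotaD -catA add0n (_ : iota A 1 = [:: A]) // cat1s.
    congr (_ ++ _ :: _).
    rewrite /subst /v2' -map_comp; apply/eq_in_map => y yv2; rewrite /comp.
    have ylt : y < A + n by move/allP: (pword_word pv2); apply.
    rewrite !nth_cat !size_iota /bump; case: (leqP A y) => ya.
      by rewrite add1n addn1 ltnNge ltnS ya subSS.
    by rewrite add0n addn1 (leqW ya) !nth_iota // (leqW ya).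
  rewrite -/(subst A.+1 v1 _) Hv1 ?size_subst //.
  exact: pword_subst pv2' spb pb.
case/andP: wp => xA wp.
by rewrite vE -(Hv2 p b wp pb spb) ffunE /= inordK.
Qed.

(** Without parameters this is Hales-Jewett. Otherwise [v] makes the colour depend only on the
    prefix before the first parameter, and [w] removes this dependence. *)
Lemma graham_rothschild a k : graham_rothschild_for a.+1 k.
Proof.
elim: k a => [|k IH] a n C.
  have [N HN] := hales_jewett a n C; exists N => chi.
  have [v [c [sv pv Hv]]] := HN chi; exists v, c; split=> // u su /pword0_word.
  exact: Hv.
have [M HM] := prefix_ramsey a n C.
have [N HN] := ramsey_up_to_prefix M C (IH a.+1).
exists N => chi.
have [v [col [sv pv Hv]]] := HN chi.
have [w [c [sw pw Hw]]] := HM col.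
exists (subst a.+1 v w), c; split; first by rewrite size_subst.
  exact: pword_subst pv sw pw.
move=> u su pu; rewrite substA; last by rewrite sw; apply: pword_word.
have := pword_subst pw su pu => /pword_split[q [r [e wq pr]]].
have sq : size q + (size r).+1 = M by rewrite -sw -(size_subst a.+1 w u) e size_cat.
rewrite e Hv // -(pre_cat r wq) -e.
have [p [b [uE wp pb]]] := pword_split pu.
rewrite uE; apply: Hw => //.
by rewrite -su uE size_cat.
Qed.

(** A word in [pword 0 k] is a partition into [k] blocks numbered by first occurrence. If nonempty
    it starts with [0], which then counts as a letter, so Graham-Rothschild over one letter applies
    to the rest. *)
Theorem dual_ramsey n k (C : finType) :
  exists N, forall chi : seq nat -> C, exists v c,
  [/\ size v = N, pword 0 n.+1 v &
      forall u, size u = n.+1 -> pword 0 k.+1 u -> chi (map (nth 0 u) v) = c].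
Proof.
have [N HN] := graham_rothschild 0 k n C; exists N.+1 => chi.
have [v [c [sv pv Hv]]] := HN (fun w => chi (0 :: w)).
exists (0 :: v), c; split; rewrite /= ?sv //.
by case=> [//|x u] [su] /= /andP[/eqP-> pu]; rewrite -(Hv u su pu).
Qed.

(** * Parameter words and first occurrences *)

Lemma pword_mem a n w i : pword a n w -> i < n -> a + i \in w.
Proof.
elim: w a n i => [|x w IH] a n i /=; first by move=> /eqP->.
case/orP=> [/andP[_ pw] ilt|/and3P[/eqP-> n0 pw]].
  by rewrite inE (IH _ _ _ pw) ?orbT.
case: i => [|i] ilt; first by rewrite addn0 mem_head.
by rewrite inE -addSnnS (IH _ _ _ pw) ?orbT // -ltnS prednK.
Qed.

Lemma pword_iota_cat a m t : word (a + m) t -> pword a m (iota a m ++ t).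
Proof.
elim: m a => [|m IH] a wt /=; last by rewrite eqxx IH ?orbT // addSnnS.
by rewrite -(cats0 t) pword_cat // -(addn0 a).
Qed.

Lemma pword_intro a k u : word (a + k) u -> (forall i, i < k -> a + i \in u) ->
  (forall i j, i < j -> j < k -> index (a + i) u < index (a + j) u) -> pword a k u.
Proof.
elim: u a k => [|x u IH] a k /=.
  by case: k => // k _ /(_ 0 isT).
case/andP=> xak wu mu iu; case: (ltnP x a) => /= xa.
  have ne i : (x == a + i) = false by apply/eqP => e; move: xa; rewrite e ltnNge leq_addr.
  rewrite IH // => [i ik|i j ij jk].
    by have := mu i ik; rewrite inE eq_sym ne.
  by have := iu i j ij jk; rewrite !ne.
have xE : x = a + (x - a) by rewrite subnKC.
have mk : x - a < k by rewrite -(ltn_add2l a) -xE.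
have {}xE : x = a.
  have [m0|m0] := posnP (x - a); first by rewrite xE m0 addn0.
  by have := iu 0 _ m0 mk; rewrite -xE eqxx ltn0.
subst x; rewrite eqxx /=; case: k xak wu mu iu mk => [|k]; rewrite ?addn0 ?ltnn //.
move=> _ wu mu iu _ /=; apply: IH; first by rewrite addSnnS.
  move=> i ik; have := mu i.+1 ik; rewrite inE addSnnS => /orP[/eqP|//].
  by lia.
move=> i j ij jk; have := iu i.+1 j.+1 ij jk; rewrite !addSnnS.
by do 2 (case: eqP => [|_]; first by lia).
Qed.

(** * Orders induced by maximal chains *)

Definition before (T : Type) (c : set (set T)) (A B : set T) :=
  exists F, [/\ c F, F `&` A !=set0 & F `<=` ~` B].

Lemma directed_closed_inter (X : topologicalType) (D : set (set X)) :
  compact [set: X] -> D !=set0 -> (forall F, D F -> closed F /\ F !=set0) ->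
  (forall F F', D F -> D F' -> exists2 E, D E & E `<=` F `&` F') ->
  exists x, forall F, D F -> F x.
Proof.
move=> cX D0 Dcl Ddir.
have FF : ProperFilter (filter_from D id).
  apply: filter_from_proper => [|F /Dcl[]//].
  by apply: filter_from_filter.
have [|x [_ clx]] := cX (filter_from D id) FF; first exact: filterT.
exists x => F DF; have [cF _] := Dcl F DF; apply: cF.
by move: clx; rewrite clusterE => /(_ F); apply; exists F.
Qed.

Lemma maximal_chain_mem (X : topologicalType) (c : set (set X)) (D : set X) :
  maximal_chain c -> closed D -> D !=set0 ->
  (forall F, c F -> F `<=` D \/ D `<=` F) -> c D.
Proof.
move=> [[ccl ctot] cmax] clD D0 cmp.
suff ch : is_chain (c `|` [set D]) by rewrite -(cmax _ ch); [right|left].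
split=> [F [/ccl//|->//]|F F' [cF|->] [cF'|->]]; [exact: ctot|exact: cmp| |by left].
by case: (cmp _ cF'); [right|left].
Qed.

Lemma maximal_chain_setT (X : topologicalType) (x : X) (c : set (set X)) :
  maximal_chain c -> c setT.
Proof.
by move=> mc; apply: (maximal_chain_mem mc closedT); [exists x|move=> F _; left].
Qed.

Lemma chain_extends (X : topologicalType) (c0 : set (set X)) : is_chain c0 ->
  exists2 c, maximal_chain c & c0 `<=` c.
Proof.
move=> ch0.
(* Zorn runs over the sets whose union with [c0] is a chain, so that the empty union qualifies
   too. *)
have [|c [cc cmax]] := @Zorn_bigcup (set X) [set c | is_chain (c0 `|` c)].
  move=> F FP Ftot; split=> [A [|[c /FP[cl _]] cA]|A A'].
  - by case: ch0 => cl _ /cl.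
  - by apply: cl; right.
  move=> [A0|[c Fc cA]] [A0'|[c' Fc' cA']].
  - by case: ch0 => _; apply.
  - by case: (FP _ Fc') => _; apply; [left|right].
  - by case: (FP _ Fc) => _; apply; [right|left].
  - case: (Ftot _ _ Fc Fc') => sub.
      by case: (FP _ Fc') => _; apply; right => //; apply: sub.
    by case: (FP _ Fc) => _; apply; right => //; apply: sub.
exists (c0 `|` c); last by move=> A; left.
split=> // c' ch' sub; apply/seteqP; split=> // A cA.
apply: contrapT => nA; apply: (cmax c').
  split; first by move=> B cB; apply: sub; right.
  by move=> /(_ A cA) ?; apply: nA; right.
by rewrite /= (_ : c0 `|` c' = c') //; apply/setUidPr => B cB; apply: sub; left.
Qed.

Section Before.
Variables (X : topologicalType) (c : set (set X)).

Lemma before_meet_sub (B F F' : set X) : is_chain c -> c F -> c F' ->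
  F `<=` ~` B -> F' `&` B !=set0 -> F `<=` F'.
Proof.
move=> [_ tot] cF cF' FB [x [F'x Bx]].
by case: (tot _ _ cF cF') => // /(_ x F'x)/FB.
Qed.

Lemma before_trans (A B D : set X) : is_chain c ->
  before c A B -> before c B D -> before c A D.
Proof.
move=> ch [F [cF FA FB]] [F' [cF' F'B F'D]]; exists F; split=> //.
exact: subset_trans (before_meet_sub ch cF cF' FB F'B) F'D.
Qed.

Lemma before_irrefl (A : set X) : ~ before c A A.
Proof. by move=> [F [_ [x [Fx Ax]] /(_ x Fx)]]. Qed.

Lemma before_asym (A B : set X) : is_chain c -> before c A B -> ~ before c B A.
Proof. by move=> ch AB BA; apply: (@before_irrefl A); apply: before_trans BA. Qed.

Lemma before_unionr (A B B' : set X) : is_chain c ->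
  before c A B -> before c A B' -> before c A (B `|` B').
Proof.
move=> [_ tot] [F [cF FA FB]] [F' [cF' F'A F'B']].
case: (tot _ _ cF cF') => sub; [exists F|exists F']; split=> // x Fx.
  by case; [exact: FB|exact: (F'B' _ (sub _ Fx))].
by case; [exact: (FB _ (sub _ Fx))|exact: F'B'].
Qed.

(** Suppose every member meeting [A] meets [B]. By compactness the intersection of these members
    meets [B]. Removing [A] from it leaves a closed set comparable with the whole chain, hence a
    member by maximality, and it meets [B] and misses [A]. *)
Lemma before_total (A B : set X) : compact [set: X] -> maximal_chain c ->
  clopen A -> clopen B -> A !=set0 -> B !=set0 -> A `&` B = set0 ->
  before c A B \/ before c B A.
Proof.
move=> cX mc [oA clA] [oB clB] A0 B0 AB0.
have [ch _] := mc; have [ccl ctot] := ch.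
have [//|nAB] := pselect (before c A B); first by left.
right; have cT : c setT by case: A0 => a _; exact: (maximal_chain_setT a).
have meetB F : c F -> F `&` A !=set0 -> F `&` B !=set0.
  move=> cF FA; apply: contrapT => FB; apply: nAB; exists F; split=> // x Fx Bx.
  by apply: FB; exists x.
have [x Hx] : exists x, forall G,
    [set G | exists2 F, c F & F `&` A !=set0 /\ G = F `&` B] G -> G x.
  apply: directed_closed_inter => //.
  - by exists (setT `&` B), setT => //; rewrite setTI.
  - move=> _ [F cF [FA ->]]; split; last exact: meetB.
    by apply: closedI => //; case: (ccl _ cF).
  - move=> _ _ [F cF [FA ->]] [F' cF' [FA' ->]].
    case: (ctot _ _ cF cF') => sub.
      by exists (F `&` B); [exists F|move=> y [Fy By]; split; split=> //; exact: sub].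
    by exists (F' `&` B); [exists F'|move=> y [Fy By]; split; split=> //; exact: sub].
pose D := \bigcap_(F in [set F | c F /\ F `&` A !=set0]) F `&` ~` A.
have xD : D x.
  split; first by move=> F [cF FA]; have [] : (F `&` B) x by apply: Hx; exists F.
  move=> Ax; have [_ Bx] : (setT `&` B) x by apply: Hx; exists setT; rewrite ?setTI.
  by have : (A `&` B) x by []; rewrite AB0.
exists D; split; [|exists x; split=> //|by move=> y []].
  apply: (maximal_chain_mem mc); last 2 first.
  - by exists x.
  - move=> F cF; have [FA|FA] := pselect (F `&` A !=set0).
      by right=> y [Dy _]; apply: Dy.
    left=> y Fy; split; last by move=> Ay; apply: FA; exists y.
    move=> F' [cF' F'A]; case: (ctot _ _ cF cF') => [|sub]; first exact.
    by exfalso; apply: FA; case: F'A => z [F'z Az]; exists z; split=> //; apply: sub.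
  apply: closedI; last exact: open_closedC.
  by rewrite /bigcap; apply: closed_bigI => F [cF _]; case: (ccl _ cF).
by have [] : (setT `&` B) x by apply: Hx; exists setT; rewrite ?setTI.
Qed.

End Before.

(** * Homeomorphisms acting on chains *)

Lemma hfun_preimage (X : topologicalType) (g : homeo X) (A B : set X) :
  (hfun g @` A) `&` B !=set0 <-> A `&` (hinv g @` B) !=set0.
Proof.
split=> [[_ [[x Ax <-] Bgx]]|[z [Az [y By yz]]]].
  by exists x; split=> //; exists (hfun g x); rewrite ?hfunK.
by exists y; split=> //; exists z; rewrite // -yz hinvK.
Qed.

Lemma before_act (X : topologicalType) (g : homeo X) c (A B : set X) :
  before (chain_act g c) A B <-> before c (hinv g @` A) (hinv g @` B).
Proof.
split=> [[_ [[F cF <-] FA FB]]|[F [cF FA FB]]].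
  exists F; split; [by []|exact/hfun_preimage|].
  by move=> x Fx [y By yx]; apply: (FB (hfun g x)); [exists x|rewrite -yx hinvK].
exists (hfun g @` F); split; [by exists F|exact/hfun_preimage|].
by move=> _ [x Fx <-] Bgx; apply: (FB x Fx); exists (hfun g x); rewrite ?hfunK.
Qed.

Lemma closed_hfun (X : topologicalType) (g : homeo X) (F : set X) :
  closed F -> closed (hfun g @` F).
Proof.
move=> clF; rewrite homeo_imageE; apply: preimage_closed => // x _.
exact: hinv_cont.
Qed.

Lemma is_chain_act (X : topologicalType) (g : homeo X) c :
  is_chain c -> is_chain (chain_act g c).
Proof.
move=> [cl tot]; split=> [_ [F cF <-]|G G' [F cF <-] [F' cF' <-]].
  have [clF [x Fx]] := cl _ cF.
  by split; [exact: closed_hfun|exists (hfun g x), x].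
by case: (tot _ _ cF cF') => sub; [left|right]; apply: image_subset.
Qed.

Lemma chain_actK (X : topologicalType) (g : homeo X) c :
  chain_act (homeo_inverse g) (chain_act g c) = c.
Proof.
have K F : hinv g @` (hfun g @` F) = F.
  rewrite image_comp (_ : hinv g \o hfun g = id) ?image_id //.
  by apply/funext => x /=; rewrite hfunK.
rewrite /chain_act image_comp -[RHS]image_id; congr (_ @` _).
exact/funext.
Qed.

Lemma homeo_inverseK (X : topologicalType) (g : homeo X) :
  homeo_inverse (homeo_inverse g) = g.
Proof. by case: g. Qed.

Lemma maximal_chain_act (X : topologicalType) (g : homeo X) c :
  maximal_chain c -> maximal_chain (chain_act g c).
Proof.
move=> [ch mx]; split; first exact: is_chain_act.
move=> c' ch' sub.
have /mx e : is_chain (chain_act (homeo_inverse g) c') by exact: is_chain_act.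
have := chain_actK (homeo_inverse g) c'; rewrite homeo_inverseK e // => F cF.
rewrite -(chain_actK g c) in cF; case: cF => F' cF' <-.
by exists F' => //; apply: sub.
Qed.

(** * Clopen partitions as labellings *)

Definition locally_constant (X : topologicalType) (T : Type) (h : X -> T) :=
  forall x, \forall y \near x, h y = h x.

Lemma locally_constant_clopen (X : topologicalType) (T : Type) (h : X -> T) :
  locally_constant h -> forall P : set T, clopen (h @^-1` P).
Proof.
move=> lch.
have op (P : set T) : open (h @^-1` P).
  by rewrite openE => x Px; apply: filterS (lch x) => y /= ->.
move=> P; split=> //.
rewrite (_ : _ @^-1` _ = ~` (h @^-1` ~` P)); first exact/open_closedC/op.
by rewrite preimage_setC setCK.
Qed.

Lemma locally_constant_comp (X : topologicalType) (T T' : Type) (h : X -> T) (f : T -> T') :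
  locally_constant h -> locally_constant (f \o h).
Proof. by move=> lch x; apply: filterS (lch x) => y /= ->. Qed.

(** Values in [nat] let a word relabel the pieces by [nth], whatever their number. *)
Definition labelling (X : topologicalType) (n : nat) (l : X -> nat) :=
  [/\ locally_constant l, forall x, l x < n & forall i, i < n -> exists x, l x = i].

Lemma labelling_relabel (X : topologicalType) n m (l : X -> nat) (v : seq nat) :
  labelling n l -> size v = n -> pword 0 m v -> labelling m (fun x => nth 0 v (l x)).
Proof.
move=> [lcl lb sur] sv pv; split.
- exact: (locally_constant_comp (nth 0 v) lcl).
- move=> x; have := pword_word pv; rewrite add0n => /allP; apply.
  by rewrite mem_nth // sv.
- move=> i im.
  have /(nthP 0)[j jv <-] : i \in v by have := pword_mem pv im; rewrite add0n.
  by rewrite sv in jv; have [x <-] := sur j jv; exists x.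
Qed.

Lemma clopen_split (X : topologicalType) :
  infinite_set [set: X] -> hausdorff_space X -> clopen_base X ->
  exists B : set X, [/\ clopen B, B !=set0 & (~` B) !=set0].
Proof.
move=> infX hX bX.
have [x _] : [set: X] !=set0 by apply/set0P; apply: contra_notN infX => /eqP ->.
have [y yx] : exists y, y != x.
  apply: contrapT => nex; apply: infX; rewrite (_ : setT = [set x]) //.
  apply/seteqP; split=> // z _; apply: contrapT => zx; apply: nex; exists z.
  exact/eqP.
have [C [clC Cx CU]] : exists C : set X, [/\ clopen C, C x & C `<=` ~` [set y]].
  apply: bX; last by move=> /= xy; rewrite xy eqxx in yx.
  by apply: closed_openC; apply: accessible_closed_set1; apply: hausdorff_accessible.
exists C; split=> //; [by exists x|exists y => Cy].
by apply: (CU y Cy).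
Qed.

Lemma homeo_part_continuous (X : topologicalType) (A : set X) (f : X -> X) x :
  open A -> A x -> {within A, continuous f} -> {for x, continuous f}.
Proof.
move=> oA Ax; rewrite continuous_open_subspace // => /(_ x); apply.
exact: mem_set.
Qed.

Lemma labelling_exists (X : topologicalType) n :
  infinite_set [set: X] -> hausdorff_space X -> clopen_base X -> h_homogeneous X ->
  exists l : X -> nat, labelling n.+1 l.
Proof.
move=> infX hX bX hh.
have [B [[oB clB] B0 [z Bz]]] := clopen_split infX hX bX.
elim: n => [|n [l [lcl lb sur]]].
  exists (fun=> 0); split=> //; first by move=> x; exact: filterE.
  by case=> // _; exists z.
have [f [g [cf cg gB fg gf]]] := hh B (conj oB clB) B0.
(* The labelling of [X] is copied into [B] with labels raised by one; the complement takes the label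
   [0]. *)
exists (fun x => if `[< B x >] then (l (f x)).+1 else 0); split.
- move=> x; have [Bx|nBx] := asboolP (B x).
    have fx := homeo_part_continuous oB Bx cf.
    have nB : \forall y \near x, B y by apply: open_nbhs_nbhs.
    have nl : \forall y \near x, l (f y) = l (f x) by apply: fx (lcl (f x)).
    by apply: filterS2 nB nl => y By ->; rewrite asboolT.
  have nB : \forall y \near x, (~` B) y.
    by apply: open_nbhs_nbhs; split=> //; apply: closed_openC.
  by apply: filterS nB => y nBy; rewrite asboolF.
- by move=> x; case: ifP => // _; rewrite ltnS; exact: lb.
- move=> [|i] ilt; first by exists z; rewrite asboolF.
  have [x lx] := sur i ilt; exists (g x).
  by rewrite asboolT ?fg ?lx.
Qed.

(** Near a point the label is constant, so the glued map agrees there with a single composite. *)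
Lemma glue_continuous (X : topologicalType) n (l : X -> nat) (F G : nat -> X -> X) :
  labelling n l ->
  (forall i, i < n -> {within l @^-1` [set i], continuous (F i)}) ->
  (forall i, i < n -> continuous (G i)) ->
  continuous (fun x => G (l x) (F (l x) x)).
Proof.
move=> [lcl lb _] cF cG x.
have cFx : {for x, continuous (F (l x))}.
  apply: homeo_part_continuous (cF _ (lb x)) => //.
  by case: (locally_constant_clopen lcl [set l x]).
have cGF : {for x, continuous (G (l x) \o F (l x))}.
  by apply: continuous_comp => //; apply: cG.
apply: cvg_trans cGF; apply: near_eq_cvg.
by apply: filterS (lcl x) => y /= ->.
Qed.

(** Every fibre is a copy of [X], so fibre [i] of [l] is sent to fibre [i] of [l'] through [X]. *)
Lemma labelling_homeo (X : topologicalType) n (l l' : X -> nat) :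
  h_homogeneous X -> labelling n l -> labelling n l' ->
  exists g : homeo X, forall x, l' (hfun g x) = l x.
Proof.
move=> hh.
have charts m : labelling n m -> exists FG : nat -> (X -> X) * (X -> X), forall i, i < n ->
    let A := m @^-1` [set i] in let f := (FG i).1 in let g := (FG i).2 in
    [/\ {within A, continuous f}, continuous g, (forall y, A (g y)),
        (forall y, f (g y) = y) & (forall a, A a -> g (f a) = a)].
  move=> [lcm _ sur].
  have [|FG H] := @choice nat ((X -> X) * (X -> X))%type (fun i fg => i < n ->
    let A := m @^-1` [set i] in
    [/\ {within A, continuous fg.1}, continuous fg.2, (forall y, A (fg.2 y)),
        (forall y, fg.1 (fg.2 y) = y) & (forall a, A a -> fg.2 (fg.1 a) = a)]).
    move=> i; have [ilt|?] := ltnP i n; last by exists (id, id).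
    have [f [g H]] := hh _ (locally_constant_clopen lcm [set i]) (sur i ilt).
    by exists (f, g).
  by exists FG.
move=> lab lab'; have [FG H] := charts l lab; have [FG' H'] := charts l' lab'.
have [_ lb _] := lab; have [_ lb' _] := lab'.
pose h x := (FG' (l x)).2 ((FG (l x)).1 x).
pose h' y := (FG (l' y)).2 ((FG' (l' y)).1 y).
have lh x : l' (h x) = l x by have [_ _ /(_ ((FG (l x)).1 x))] := H' _ (lb x).
have lh' y : l (h' y) = l' y by have [_ _ /(_ ((FG' (l' y)).1 y))] := H _ (lb' y).
have hK : cancel h h'.
  move=> x; rewrite /h' lh /h.
  have [_ _ _ -> _] := H' _ (lb x).
  by have [_ _ _ _ ->] := H _ (lb x).
have h'K : cancel h' h.
  move=> y; rewrite /h lh' /h'.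
  have [_ _ _ -> _] := H _ (lb' y).
  by have [_ _ _ _ ->] := H' _ (lb' y).
have ch : continuous h.
  apply: (glue_continuous (F := fun i => (FG i).1) (G := fun i => (FG' i).2) lab).
    by move=> i /H[].
  by move=> i /H'[].
have ch' : continuous h'.
  apply: (glue_continuous (F := fun i => (FG' i).1) (G := fun i => (FG i).2) lab').
    by move=> i /H'[].
  by move=> i /H[].
by exists (Homeo hK h'K ch ch').
Qed.

(** * Ranks and the factor map *)

(** Values stay below [k]; the type ['I_k.+1] is inhabited for every [k], as [inord] requires. *)
Definition rank (T : Type) (k : nat) (c : set (set T)) (B : 'I_k -> set T) :
  {ffun 'I_k -> 'I_k.+1} :=
  [ffun j => inord #|[pred i | `[< before c (B i) (B j) >]]|].

Section Rank.
Variables (X : topologicalType) (k : nat) (c : set (set X)) (B : 'I_k -> set X).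
Hypotheses (cX : compact [set: X]) (mc : maximal_chain c) (pB : ordpartb B).

Let ch : is_chain c. Proof. by case: mc. Qed.

Lemma rankE j : rank c B j = #|[pred i | `[< before c (B i) (B j) >]]| :> nat.
Proof. by rewrite ffunE inordK // ltnS -[X in _ <= X]card_ord max_card. Qed.

Lemma before_rank i j : before c (B i) (B j) -> rank c B i < rank c B j.
Proof.
move=> ij; rewrite !rankE; apply/proper_card/properP; split.
  apply/fintype.subsetP => m; rewrite !inE => mi.
  exact: before_trans ch mi ij.
exists i; first by rewrite inE.
by apply/negP; rewrite inE; apply: before_irrefl.
Qed.

Lemma ordpart_before_total i j : i != j ->
  before c (B i) (B j) \/ before c (B j) (B i).
Proof. by case: pB => cl ne dj _ ij; apply: before_total => //; exact: dj. Qed.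

Lemma rank_before i j : rank c B i < rank c B j -> before c (B i) (B j).
Proof.
move=> lt; have ij : i != j by apply: contraTneq lt => ->; rewrite ltnn.
by have [//|/before_rank] := ordpart_before_total ij; rewrite ltnNge ltnW.
Qed.

Lemma rank_inj : injective (rank c B).
Proof.
move=> i j e; apply/eqP; apply: contraT => ij.
by have [] := ordpart_before_total ij => /before_rank; rewrite e ltnn.
Qed.

Lemma rank_bound j : rank c B j < k.
Proof.
rewrite rankE -[X in _ < X]card_ord; apply/proper_card/properP; split; first exact/fintype.subsetP.
by exists j => //; apply/negP; rewrite inE; apply: before_irrefl.
Qed.

Lemma rank_onto m : m < k -> exists j, rank c B j = m :> nat.
Proof.
move=> mk; pose r j := Ordinal (rank_bound j).
have inj : injective r by move=> i j [] /val_inj; apply: rank_inj.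
exists (invF inj (Ordinal mk)).
by have := f_invF inj (Ordinal mk) => /(congr1 val).
Qed.

Lemma ordpart_label : exists lab : X -> 'I_k,
  locally_constant lab /\ forall x i, B i x <-> lab x = i.
Proof.
case: pB => cl _ dj cv; have [lab Hlab] := choice cv.
have labP x i : B i x <-> lab x = i.
  split=> [Bix|<-]; last exact: Hlab.
  apply/eqP; apply: contraT => ne; have : (B (lab x) `&` B i) x by split.
  by rewrite dj.
exists lab; split=> // x; have [oB _] := cl (lab x).
have : \forall y \near x, B (lab x) y by apply: open_nbhs_nbhs; split=> //; apply/labP.
by apply: filterS => y /labP.
Qed.

(* The parameters of the word name the blocks of [B] by increasing rank; a
   block of smaller rank meets a smaller member of [c], hence shows up first
   among the fibres of [l]. *)
Lemma ordpart_word n (l : X -> nat) : labelling n l ->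
  (forall i j, i < j -> j < n -> before c (l @^-1` [set i]) (l @^-1` [set j])) ->
  (forall x y, l x = l y -> forall i, B i x -> B i y) ->
  exists u, [/\ size u = n, pword 0 k u &
    forall j x, B j x <-> nth 0 u (l x) = rank c B j].
Proof.
move=> [_ lb sur] srt refn; have [lab [_ labP]] := ordpart_label.
have labE x y : l x = l y -> lab x = lab y.
  by move=> lxy; apply/esym/labP; apply: (refn x) => //; apply/labP.
have [u [su uE]] : exists u, size u = n /\ forall x, nth 0 u (l x) = rank c B (lab x).
  have [pt Hpt] := @choice 'I_n X (fun i x => l x = i) (fun i => sur i (ltn_ord i)).
  exists [seq nat_of_ord (rank c B (lab (pt i))) | i <- enum 'I_n].
  split; first by rewrite size_map size_enum_ord.
  move=> x; rewrite (nth_map (Ordinal (lb x))) ?size_enum_ord //.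
  by rewrite (labE _ x) // Hpt nth_enum_ord.
have uP j x : B j x <-> nth 0 u (l x) = rank c B j.
  rewrite uE labP; split=> [->//|/val_inj]; exact: rank_inj.
exists u; split=> //; apply: pword_intro.
- apply/allP => _ /(nthP 0)[i iu <-]; rewrite su in iu.
  by have [x <-] := sur i iu; rewrite uE rank_bound.
- move=> i ik; have [j <-] := rank_onto ik; rewrite add0n.
  case: pB => _ /(_ j)[x /uP <-] _ _; apply: mem_nth; rewrite su; exact: lb.
move=> i0 j0; rewrite !add0n => ij jk.
have [i ei] := rank_onto (ltn_trans ij jk); have [j ej] := rank_onto jk.
rewrite -ei -ej in ij *.
have [F [cF [x [Fx Bix]] FBj]] := rank_before ij.
have [_ neB _ _] := pB; have [y Bjy] := neB j.
have ju : nat_of_ord (rank c B j) \in u.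
  by rewrite -(iffLR (uP j y) Bjy) mem_nth // su.
have [z lz] : exists z, l z = index (nat_of_ord (rank c B j)) u.
  by apply: sur; rewrite -su index_mem.
have Bjz : B j z by apply/uP; rewrite lz nth_index.
have le_x : index (nat_of_ord (rank c B i)) u <= l x.
  by rewrite -(iffLR (uP i x) Bix); apply: index_nth; rewrite su.
(* If block [j] showed up before the label of [x], the fibre of [z] would precede that of [x]; but
   [F] meets the latter and misses the former. *)
apply: leq_ltn_trans le_x _; rewrite -lz ltnNge; apply/negP => zx.
have {}zx : l z < l x.
  rewrite ltn_neqAle zx andbT; apply/eqP => e.
  by apply: (FBj x Fx); apply: refn Bjz.
have zbx := srt _ _ zx (lb x).
apply: (before_asym ch zbx); exists F; split=> //; first by exists x.
by move=> t Ft lt; apply: (FBj t Ft); apply: refn Bjz; rewrite lt.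
Qed.

End Rank.

(** Only the nonempty fibres of [h] are listed, since [before] is total on these; the labels are the
    indices in the sorted list. *)
Lemma sorted_fibres (X : topologicalType) (T : finType) (h : X -> T) (c : set (set X)) :
  compact [set: X] -> maximal_chain c -> locally_constant h ->
  exists n l, [/\ labelling n l,
    forall i j, i < j -> j < n -> before c (l @^-1` [set i]) (l @^-1` [set j]) &
    forall x y, l x = l y -> h x = h y].
Proof.
move=> cX mc lch; have [ch _] := mc.
pose below t t' := before c (h @^-1` [set t]) (h @^-1` [set t']).
pose r : rel T := fun t t' => `[< t = t' \/ below t t' >].
pose ts := [seq t <- enum T | `[< exists x, h x = t >]].
have tsP t : (t \in ts) = `[< exists x, h x = t >] by rewrite mem_filter mem_enum andbT.
have r_trans : transitive r.
  move=> b a d /asboolP[->//|ab] /asboolP[<-|bd]; apply/asboolP; right=> //.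
  exact: before_trans ch ab bd.
have r_total : {in mem ts &, total r}.
  move=> a b; rewrite !tsP => /asboolP[x hx] /asboolP[y hy].
  have [ab|ab] := eqVneq a b; first by apply/orP; left; apply/asboolP; left.
  have [|||||ab'|ba'] := @before_total X c (h @^-1` [set a]) (h @^-1` [set b]) cX mc.
  - exact: locally_constant_clopen.
  - exact: locally_constant_clopen.
  - by exists x.
  - by exists y.
  - by apply/seteqP; split=> // z [/= -> e]; rewrite e eqxx in ab.
  - by apply/orP; left; apply/asboolP; right.
  - by apply/orP; right; apply/asboolP; right.
pose ss := sort r ts.
have ss_sorted : sorted r ss by apply: (sort_sorted_in r_total); apply/allP.
have ss_uniq : uniq ss by rewrite sort_uniq filter_uniq ?enum_uniq.
have h_ss x : h x \in ss by rewrite mem_sort tsP; apply/asboolP; exists x.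
have fibre t0 i : i < size ss ->
    (fun x => index (h x) ss) @^-1` [set i] = h @^-1` [set nth t0 ss i].
  move=> iss; apply/seteqP; split=> x /= e; first by rewrite -e nth_index.
  by rewrite e index_uniq.
exists (size ss), (fun x => index (h x) ss); split.
- split; first exact: (locally_constant_comp (index^~ ss) lch).
    by move=> x; rewrite index_mem.
  move=> i iss; have t0 : T by case: (ss) iss => // t.
  have : nth t0 ss i \in ts by rewrite -(mem_sort r) mem_nth.
  by rewrite tsP => /asboolP[x hx]; exists x; rewrite hx index_uniq.
- move=> i j ij jss; have iss := ltn_trans ij jss.
  have t0 : T by case: (ss) iss => // t.
  rewrite !(fibre t0) //.
  have /asboolP[e|//] := sorted_ltn_nth r_trans t0 ss_sorted i j iss jss ij.
  by move/eqP: e; rewrite nth_uniq // ltn_eqF.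
- by move=> x y e; rewrite -(nth_index (h x) (h_ss x)) e nth_index.
Qed.

Lemma labelling_gt0 (X : topologicalType) n (l : X -> nat) (x : X) : labelling n l -> 0 < n.
Proof. by move=> [_ lb _]; apply: leq_ltn_trans (lb x). Qed.

(** * Homogeneous partitions and orbit closures *)

Section Omega.
Variables (X : topologicalType) (k : nat).
Implicit Types (w : Omega X k) (S : set (Omega X k)).

Local Notation colour := {ffun {ffun 'I_k -> 'I_k.+1} -> bool}.

(** A total extension of [w], so that words can be coloured before they are known to yield
    partitions. *)
Definition omega_ext w (B : 'I_k -> set X) : bool :=
  if pselect (ordpartb B) is left pB then w (exist _ B pB) else false.

Lemma omega_extE w (b : ordpart X k) : omega_ext w (proj1_sig b) = w b.
Proof.
case: b => B pB; rewrite /omega_ext /=; case: pselect => // pB'.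
by congr w; apply: eq_exist.
Qed.

(* [w] colours every ordered partition coarser than [l] by [f], evaluated at the
   positions its blocks take when sorted by first occurrence among the fibres of [l]. *)
Definition homogeneous w n (f : colour) := exists l : X -> nat, labelling n l /\
  forall u, size u = n -> pword 0 k u ->
  forall (s : {ffun 'I_k -> 'I_k.+1}) (b : ordpart X k),
    (forall j x, proj1_sig b j x <-> nth 0 u (l x) = s j) -> w b = f s.

(** Labels from [m] on are merged into label [0], which keeps first occurrences in order. *)
Lemma homogeneousW w n m f : homogeneous w n f -> 0 < m -> m <= n -> homogeneous w m f.
Proof.
move=> [l [lab Hl]] m0 mn.
pose v := iota 0 m ++ nseq (n - m) 0.
have sv : size v = n by rewrite size_cat size_iota size_nseq subnKC.
have pv : pword 0 m v by apply: pword_iota_cat; apply/allP => x /nseqP[-> _].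
exists (fun x => nth 0 v (l x)); split; first exact: labelling_relabel lab sv pv.
move=> u su pu s b bE; apply: (Hl (map (nth 0 u) v)); rewrite ?size_map //.
  exact: pword_subst pv su pu.
move=> j x; rewrite bE (nth_map 0) // sv; have [_ lb _] := lab; exact: lb.
Qed.

(** A word is coloured by a whole function of [s]: the value of [w] at the partition whose block [j]
    carries the label [s j]. The constant colour is then [f]. *)
Lemma homogeneous_exists w n : 0 < k ->
  infinite_set [set: X] -> hausdorff_space X -> clopen_base X -> h_homogeneous X ->
  exists f, homogeneous w n.+1 f.
Proof.
move=> k0 infX hX bX hh.
have [N HN] := dual_ramsey n k.-1 colour; rewrite prednK // in HN.
case: N HN => [|N] HN.
  by have [v [c [/size0nil-> ]]] := HN (fun=> [ffun=> true]).
have [l lab] := labelling_exists N infX hX bX hh.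
have [v [f [sv pv Hv]]] := HN (fun t =>
  [ffun s : {ffun 'I_k -> 'I_k.+1} => omega_ext w (fun j => [set x | nth 0 t (l x) = s j])]).
exists f, (fun x => nth 0 v (l x)); split; first exact: labelling_relabel lab sv pv.
move=> u su pu s b bE.
have /ffunP/(_ s) := Hv u su pu; rewrite ffunE -omega_extE => <-; congr omega_ext.
apply/funext => j; apply/seteqP.
have [_ lb _] := lab.
by split=> x /=; rewrite (nth_map 0) ?sv // => /bE.
Qed.

(** There are finitely many [f]. If each failed at some size, none would work beyond the largest of
    these, since homogeneity passes to smaller sizes. *)
Lemma homogeneous_uniform w : 0 < k ->
  infinite_set [set: X] -> hausdorff_space X -> clopen_base X -> h_homogeneous X ->
  exists f, forall n, 0 < n -> homogeneous w n f.
Proof.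
move=> k0 infX hX bX hh; apply: contrapT => none.
have [nf Hnf] : {nf : colour -> nat & forall f, 0 < nf f /\ ~ homogeneous w (nf f) f}.
  apply: (@choice colour nat (fun f n => 0 < n /\ ~ homogeneous w n f)) => f.
  apply: contrapT => nex; apply: none; exists f => n n0.
  by apply: contrapT => nh; apply: nex; exists n.
have [f Hf] := homogeneous_exists w (\max_f nf f) k0 infX hX bX hh.
have [nf0] := Hnf f; apply; apply: homogeneousW Hf nf0 _.
by apply: leqW; apply: leq_bigmax.
Qed.

Lemma omega_closedP S :
  (forall w, (forall m (b : 'I_m -> ordpart X k),
     exists2 w', S w' & forall i, w' (b i) = w (b i)) -> S w) <-> omega_closed S.
Proof.
split=> [clS w nSw|clS w adh].
  apply: contrapT => nex; apply: nSw; apply: clS => m b.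
  apply: contrapT => nw'; apply: nex.
  exists m, (fun i => [set w' | w' (b i) = w (b i)]); split=> //.
    by move=> i; exists (b i), (w (b i)).
  by move=> w' e Sw'; apply: nw'; exists w'.
apply: contrapT => /clS[m [V [sub Vw Vsub]]].
have [b Hb] := @choice 'I_m (ordpart X k) (fun i b => exists s, V i = [set w | w b = s]) sub.
have [w' Sw' e] := adh m b; apply: (Vsub w') => // i.
by have := Vw i; have [s ->] := Hb i; rewrite /= e.
Qed.

Definition rank_colouring (f : colour) (c : set (set X)) : Omega X k :=
  fun b => f (rank c (proj1_sig b)).

(** By closedness it suffices to match finitely many [b i]. Their common refinement, sorted by [c],
    is the image under some [g] of a partition homogeneous for [w], so [omega_act g w] has the
    required values there. *)
Lemma rank_colouring_mem (x0 : X) S w f c : compact [set: X] -> h_homogeneous X ->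
  maximal_chain c ->
  omega_subsystem S -> S w -> (forall n, 0 < n -> homogeneous w n f) ->
  S (rank_colouring f c).
Proof.
move=> cX hh mc [_ /omega_closedP clS invS] Sw Hf; apply: clS => m b.
have labs i := ordpart_label (proj2_sig (b i)).
have [lab Hlab] := choice labs.
pose h x := [ffun i => lab i x].
have lch : locally_constant h.
  move=> x; have : \forall y \near x, forall i, lab i y = lab i x.
    by apply: filter_forall => i; have [+ _] := Hlab i; apply.
  by apply: filterS => y e; apply/ffunP => i; rewrite !ffunE.
have [n [l [labl srt lh]]] := sorted_fibres cX mc lch.
have [l' [labl' Hl']] := Hf n (labelling_gt0 x0 labl).
have [g lg] := labelling_homeo hh labl' labl.
exists (omega_act g w); first exact: invS.
move=> i.
have refn x y : l x = l y -> forall j, proj1_sig (b i) j x -> proj1_sig (b i) j y.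
  move=> /lh /ffunP/(_ i); rewrite !ffunE => e j.
  by have [_ labP] := Hlab i; rewrite !labP e.
have [u [su pu uP]] := ordpart_word cX mc (proj2_sig (b i)) labl srt refn.
apply: (Hl' u) => // j x.
rewrite -[X in X <-> _]/((hfun (homeo_inverse g) @` proj1_sig (b i) j) x).
by rewrite homeo_imageE /= uP lg.
Qed.

Lemma rank_colouring_act f c g :
  rank_colouring f (chain_act g c) = omega_act g (rank_colouring f c).
Proof.
apply/funext => b; rewrite /rank_colouring /omega_act /=; congr (f _).
apply/ffunP => j; rewrite !ffunE; congr inord; apply: eq_card => i.
by rewrite !inE /=; apply: asbool_equiv_eq; apply: before_act.
Qed.

End Omega.

(** * Limits of chains, closed image and continuity *)

Lemma eq_rank (X : topologicalType) k (c c' : set (set X)) (B : 'I_k -> set X) :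
  compact [set: X] -> maximal_chain c -> maximal_chain c' -> ordpartb B ->
  (forall i j, before c (B i) (B j) -> before c' (B i) (B j)) -> rank c B = rank c' B.
Proof.
move=> cX mc mc' pB sub; apply/ffunP => j; rewrite !ffunE; congr inord.
apply: eq_card => i; rewrite !inE; apply: asbool_equiv_eq.
split=> [|ij]; first exact: sub.
have ne : i != j by apply/eqP => e; move: ij; rewrite e; apply: before_irrefl.
(* Conversely, if [i] did not precede [j] for [c], then [j] would precede [i] for [c], hence for
   [c'], against [ij]. *)
have [//|/sub ji] := ordpart_before_total cX mc pB ne.
by case: mc' => ch' _; case: (before_asym ch' ij ji).
Qed.

(** [lim A] avoids every clopen [B] that [A] precedes for [U]-most chains, and still meets [A] by
    compactness. The sets [lim A] are nested, so they lie in a maximal chain, where they witness the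
    limit relations. *)
Lemma limit_chain (X : topologicalType) (x0 : X) (U : set_system (set (set X))) :
  compact [set: X] -> ProperFilter U ->
  (forall A B : set X, U [set c | before c A B] \/ U [set c | ~ before c A B]) ->
  U (@Phi X) -> exists2 c, maximal_chain c &
    forall A B : set X, clopen A -> A !=set0 -> clopen B ->
      U [set c | before c A B] -> before c A B.
Proof.
move=> cX FU dec UP.
have Uch : U [set c | is_chain c] by apply: filterS UP => c [].
pose lim A := \bigcap_(B in [set B | clopen B /\ U [set c | before c A B]]) ~` B.
have lim_closed A : closed (lim A).
  by apply: closed_bigI => B [[oB _] _]; apply: open_closedC.
have lim_meets A : clopen A -> A !=set0 -> lim A `&` A !=set0.
  move=> [oA clA] A0.
  (* The case [B = set0] makes this family nonempty and puts [x] in [A]. *)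
  have [x Hx] : exists x, forall G, [set G | exists2 B,
      clopen B /\ U [set c | before c A B] & G = A `&` ~` B] G -> G x.
    apply: directed_closed_inter => //.
    - exists (A `&` ~` set0), set0 => //; split.
        by split; [exact: open0|exact: closed0].
      apply: filterS UP => c mc; exists setT; split; last by move=> ? _ [].
        exact: maximal_chain_setT.
      by rewrite setTI.
    - move=> _ [B [[oB clB] UB] ->]; split.
        by apply: closedI => //; apply: open_closedC.
      by have [c [F [_ [x [Fx Ax]] FB]]] := filter_ex UB; exists x; split=> //; apply: FB.
    - move=> _ _ [B [clB UB] ->] [B' [clB' UB'] ->]; exists (A `&` ~` (B `|` B')).
        exists (B `|` B') => //; split; first exact: clopenU.
        apply: filterS (filterI Uch (filterI UB UB')) => c [ch [AB AB']].
        exact: before_unionr.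
      by move=> y [Ay nBy]; split; split=> // ?; apply: nBy; [left|right].
  exists x; split.
    by move=> B [clB UB]; have [] : (A `&` ~` B) x by apply: Hx; exists B.
  have [] // : (A `&` ~` set0) x; apply: Hx; exists set0 => //; split.
    by split; [exact: open0|exact: closed0].
  apply: filterS UP => c mc; exists setT; split; last by move=> ? _ [].
    exact: maximal_chain_setT.
  by rewrite setTI.
have [|c mc sub] := @chain_extends X (lim @` [set A | clopen A /\ A !=set0]).
  split=> [_ [A [clA A0] <-]|G G' [A [clA A0] <-] [A' [clA' A'0] <-]].
    by split=> //; have [x [? _]] := lim_meets A clA A0; exists x.
  have [all|/existsNP[B /not_implyP[UA'B nUAB]]] :=
    pselect (forall B, U [set c | before c A' B] -> U [set c | before c A B]).
    by left=> x Hx B [clB UB]; apply: Hx; split=> //; apply: all.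
  (* For [U]-most chains [A'] precedes [B] and [A] does not. A member meeting [A] and missing [B']
     then meets [B], so it contains a member that meets [A'] and misses [B]; thus [A'] precedes
     [B']. *)
  right=> x Hx B' [clB' UAB']; apply: Hx; split=> //.
  have {nUAB} UnAB : U [set c | ~ before c A B] by case: (dec A B).
  apply: filterS (filterI (filterI Uch UAB') (filterI UA'B UnAB)).
  move=> c [[ch [F [cF FA FB']]] [[F' [cF' F'A' F'B]] nAB]].
  exists F'; split=> //; apply: subset_trans FB'.
  apply: (before_meet_sub ch cF' cF F'B); apply: contrapT => FB; apply: nAB.
  by exists F; split=> // y Fy By; apply: FB; exists y.
exists c => // A B clA A0 clB UAB; exists (lim A); split.
- by apply: sub; exists A.
- exact: lim_meets.
- by move=> x; apply.
Qed.

Section Factor.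
Variables (X : topologicalType) (k : nat) (f : {ffun {ffun 'I_k -> 'I_k.+1} -> bool}).
Hypothesis cX : compact [set: X].

(** The chains agreeing with an adherent [w] on finite lists of partitions generate a filter. A
    limit chain along a finer ultrafilter orders the blocks of [b] as most of these chains do, so
    its value at [b] is [w b]. *)
Lemma rank_colouring_closed (x0 : X) : omega_closed (rank_colouring f @` @Phi X).
Proof.
apply/omega_closedP => w adh.
pose fam m (b : 'I_m -> ordpart X k) := existT (fun m => 'I_m -> ordpart X k) m b.
have none : 'I_0 -> ordpart X k by case.
pose E (d : {m & 'I_m -> ordpart X k}) := [set c | maximal_chain c /\
  forall i, rank_colouring f c (projT2 d i) = w (projT2 d i)].
have FE : ProperFilter (filter_from setT E).
  apply: filter_from_proper => [|[m b] _]; last first.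
    by have [_ [c mc <-] e] := adh m b; exists c.
  apply: filter_from_filter; first by exists (fam _ none).
  move=> [m b] [m' b'] _ _.
  exists (fam (m + m') (fun i =>
    match fintype.split i with inl j => b j | inr j => b' j end)) => //.
  move=> c [mc e]; split; split=> //= i.
    by have := e (unsplit (inl i)); rewrite /= -/(unsplit (inl i)) unsplitK.
  by have := e (unsplit (inr i)); rewrite /= -/(unsplit (inr i)) unsplitK.
have [U [UU FU]] := ultraFilterLemma FE.
have PU : ProperFilter U by case: UU.
have UE d : U (E d) by apply: FU; exists d.
have UP : U (@Phi X).
  by apply: filterS (UE (fam _ none)) => c [].
have [A B|c mc clim] := limit_chain x0 cX PU _ UP; first exact: in_ultra_setVsetC.
exists c => //; apply/funext => b.
have [cl ne dj _] := proj2_sig b.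
have near_c : \forall c' \near U, forall i j,
    before c (proj1_sig b i) (proj1_sig b j) -> before c' (proj1_sig b i) (proj1_sig b j).
  apply: filter_forall => i; apply: filter_forall => j.
  have [ij|nij] := pselect (before c (proj1_sig b i) (proj1_sig b j)); last first.
    by apply: filterE => c' /nij.
  case: (in_ultra_setVsetC [set c' | before c' (proj1_sig b i) (proj1_sig b j)] UU) => [Uij|Unij].
    by apply: filterS Uij.
  (* Otherwise [j] precedes [i] for [U]-most chains by totality, hence also for the limit [c]. *)
  have ne_ij : i != j by apply/eqP => e; move: ij; rewrite e; apply: before_irrefl.
  have [ch _] := mc; case: (before_asym ch ij); apply: clim => //.
  apply: filterS (filterI UP Unij) => c' [mc' nij'].
  by case: (ordpart_before_total cX mc' (proj2_sig b) ne_ij).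
have [c' [imp [mc' e]]] := filter_ex (filterI near_c (UE (fam 1 (fun=> b)))).
rewrite -(e ord0) /rank_colouring; congr (f _).
exact: (eq_rank cX mc mc' (proj2_sig b) imp).
Qed.

(** Meeting [A] is a Vietoris open condition as [A] is open, missing [B] as [B] is closed. *)
Lemma before_exp2_open (A B : set X) : clopen A -> clopen B ->
  exists2 O, @exp_open X O & forall c, before c A B <-> c `&` O !=set0.
Proof.
move=> [oA _] [_ clB].
exists [set F | F `&` A !=set0 /\ F `<=` ~` B]; last first.
  by move=> c; split=> [[F [cF FA FB]]|[F [cF [FA FB]]]]; exists F.
move=> F [FA FB].
exists 2, (fun i : 'I_2 => if i == ord0 then [set F | F `&` A !=set0]
                           else [set F | F `<=` ~` B]); split.
- move=> i; case: ifP => _; first by exists A; split=> //; right.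
  by exists (~` B); split; [exact: closed_openC|left].
- by move=> i; case: ifP.
- by move=> G GV; split; [exact: (GV ord0)|exact: (GV (lift ord0 ord0))].
Qed.

Lemma rank_colouring_continuous : phi_continuous (@rank_colouring X k f).
Proof.
move=> b s c mc cs; have [cl _ _ _] := proj2_sig b.
have opens (q : 'I_k * 'I_k) : exists O, exp_open O /\
    forall d, before d (proj1_sig b q.1) (proj1_sig b q.2) <-> d `&` O !=set0.
  by have [V openV HV] := before_exp2_open (cl q.1) (cl q.2); exists V.
have [V HV] := choice opens.
pose W := [set d | forall i j, before c (proj1_sig b i) (proj1_sig b j) ->
  before d (proj1_sig b i) (proj1_sig b j)].
exists W; split=> // [d Wd|c' mc' Wc'].
  (* One subbasic set per pair of blocks; pairs not ordered by [c] get a condition that always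
     holds. *)
  exists #|{: 'I_k * 'I_k}|, (fun m => let q := enum_val m in
    if `[< before c (proj1_sig b q.1) (proj1_sig b q.2) >]
    then [set d | d `&` V q !=set0] else [set d | d `<=` setT]); split.
  - move=> m /=; case: ifP => _.
      by exists (V (enum_val m)); split; [case: (HV (enum_val m))|right].
    exists setT; split; last by left.
    by move=> F _; exists 0, (fun=> setT); split=> // -[].
  - by move=> m /=; case: asboolP => // /Wd; case: (HV (enum_val m)) => _ ->.
  - move=> d' dV i j ij; have := dV (enum_rank (i, j)).
    by rewrite /= enum_rankK asboolT //=; case: (HV (i, j)) => _ <-.
by rewrite -cs /rank_colouring (eq_rank cX mc mc' (proj2_sig b) Wc').
Qed.

End Factor.

Theorem theorem4p9 (X : topologicalType) (k : nat) :
  infinite_set [set: X] -> compact [set: X] -> hausdorff_space X ->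
  clopen_base X -> h_homogeneous X -> (1 <= k)%N ->
  forall S : set (Omega X k), minimal_subsystem S -> factor_of_Phi S.
Proof.
move=> infX cX hX bX hh k0 S [subS minS].
have [_ [_ [x0 _] _]] := clopen_split infX hX bX.
have [[w Sw] _ _] := subS.
have [f Hf] := homogeneous_uniform w k0 infX hX bX hh.
have memS c : @Phi X c -> S (rank_colouring f c).
  by move=> mc; apply: (rank_colouring_mem x0 cX hh mc subS Sw Hf).
have imS : rank_colouring f @` @Phi X = S.
  apply: minS; last by move=> _ [c mc <-]; exact: memS.
  split; last 2 first.
  - exact: rank_colouring_closed.
  - move=> g _ [c mc <-]; exists (chain_act g c); first exact: maximal_chain_act.
    exact: rank_colouring_act.
  (* The image is nonempty because the empty chain extends to a maximal one. *)
  have [|c mc _] := @chain_extends X set0; first by split.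
  by exists (rank_colouring f c), c.
exists (rank_colouring f); split=> //.
- by rewrite -imS => w' [c mc <-]; exists c.
- exact: rank_colouring_continuous.
- by move=> g c _; apply: rank_colouring_act.
Qed.
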